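(* Let $c\ge1$. For a $c$-$\mathsf{Lie}$-central extension $\pi:\mathfrak g\twoheadrightarrow\mathfrak q$ of Leibniz algebras, with $\mathfrak n=\ker(\pi)$, the following statements are equivalent: (a) $\pi:\mathfrak g\twoheadrightarrow\mathfrak q$ is a $c$-$\mathsf{Lie}$-stem extension. (b) The induced map $\mathfrak n\to\mathfrak g/\gamma_{c+1}^{\mathsf{Lie}}(\mathfrak g)$ is the zero map. (c) $\theta:\mathcal M_{\mathsf{Lie}}^{(c)}(\mathfrak q)\to\mathfrak n$ is an epimorphism. (d) The sequence $\mathfrak n\otimes^c\mathfrak g_{\mathsf{Lie}}\to\mathcal M_{\mathsf{Lie}}^{(c)}(\mathfrak g)\to\mathcal M_{\mathsf{Lie}}^{(c)}(\mathfrak q)\xrightarrow{\theta}\mathfrak n\to0$ is exact. (e) $\mathfrak g/\gamma_{c+1}^{\mathsf{Lie}}(\mathfrak g)\cong\mathfrak q/\gamma_{c+1}^{\mathsf{Lie}}(\mathfrak q)$.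
   Context: $\mathbb K$ is a field with $\frac12\in\mathbb K$. A Leibniz algebra is a $\mathbb K$-vector space with a bilinear bracket satisfying $[x,[y,z]]=[[x,y],z]-[[x,z],y]$. Write $[x,y]_{\mathsf{Lie}}=[x,y]+[y,x]$. For two-sided ideals $\mathfrak m,\mathfrak n$ of $\mathfrak g$, $[\mathfrak m,\mathfrak n]_{\mathsf{Lie}}$ is the span of all $[m,n]_{\mathsf{Lie}}$, $m\in\mathfrak m$, $n\in\mathfrak n$. For a two-sided ideal $\mathfrak n$: $\gamma_1^{\mathsf{Lie}}(\mathfrak g,\mathfrak n)=\mathfrak n$, $\gamma_i^{\mathsf{Lie}}(\mathfrak g,\mathfrak n)=[\gamma_{i-1}^{\mathsf{Lie}}(\mathfrak g,\mathfrak n),\mathfrak g]_{\mathsf{Lie}}$ for $i\ge2$, and $\gamma_i^{\mathsf{Lie}}(\mathfrak g)=\gamma_i^{\mathsf{Lie}}(\mathfrak g,\mathfrak g)$. A short exact sequence $0\to\mathfrak n\to\mathfrak g\xrightarrow{\pi}\mathfrak q\to0$ is a $c$-$\mathsf{Lie}$-central extension if $\gamma_{c+1}^{\mathsf{Lie}}(\mathfrak g,\mathfrak n)=0$, and a $c$-$\mathsf{Lie}$-stem extension if moreover $\mathfrak n\subseteq\gamma_{c+1}^{\mathsf{Lie}}(\mathfrak g)$. $\mathfrak g_{\mathsf{Lie}}=\mathfrak g/\mathfrak g^{\rm ann}$, where $\mathfrak g^{\rm ann}$ is spanned by all $[x,x]$, and $\mathfrak n\otimes^c\mathfrak g_{\mathsf{Lie}}$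 denotes $\mathfrak n$ tensored with $c$ copies of $\mathfrak g_{\mathsf{Lie}}$. Let $0\to\mathfrak r\to\mathfrak f\xrightarrow{\rho}\mathfrak g\to0$ be a free presentation ($\mathfrak f$ a free Leibniz algebra) and $\mathfrak s=\ker(\pi\circ\rho)$. Then $\mathcal M_{\mathsf{Lie}}^{(c)}(\mathfrak g)=(\mathfrak r\cap\gamma_{c+1}^{\mathsf{Lie}}(\mathfrak f))/\gamma_{c+1}^{\mathsf{Lie}}(\mathfrak f,\mathfrak r)$ and $\mathcal M_{\mathsf{Lie}}^{(c)}(\mathfrak q)=(\mathfrak s\cap\gamma_{c+1}^{\mathsf{Lie}}(\mathfrak f))/\gamma_{c+1}^{\mathsf{Lie}}(\mathfrak f,\mathfrak s)$; the map $\mathcal M_{\mathsf{Lie}}^{(c)}(\mathfrak g)\to\mathcal M_{\mathsf{Lie}}^{(c)}(\mathfrak q)$ is induced by $\mathfrak r\subseteq\mathfrak s$, and $\theta(x+\gamma_{c+1}^{\mathsf{Lie}}(\mathfrak f,\mathfrak s))=\rho(x)$. The first map in (d) sends $n\otimes\overline{g_1}\otimes\dots\otimes\overline{g_c}$ to $[\dots[[s,f_1]_{\mathsf{Lie}},f_2]_{\mathsf{Lie}},\dots,f_c]_{\mathsf{Lie}}+\gamma_{c+1}^{\mathsf{Lie}}(\mathfrak f,\mathfrak r)$, where $\rho(s)=n$ and $\rho(f_i)=g_i$. The map in (b) is the inclusion $\mathfrak n\subseteq\mathfrak g$ followed by the projection.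
   Formalization: In (d) the first map is not always well defined, so it is replaced by the linear relation spanned by the prescribed pairs (its graph whenever the map exists); in (e) the isomorphism is the one induced by π, since with an arbitrary isomorphism the equivalence fails in infinite dimension. *)

(* Defs.v *)
From HB Require Import structures.
From mathcomp Require Import all_boot all_order all_algebra.
From mathcomp Require Import boolp classical_sets.
From mathcomp Require Import freeg.

Set Implicit Arguments.
Unset Strict Implicit.
Unset Printing Implicit Defensive.

Import GRing.Theory.
Local Open Scope ring_scope.
Local Open Scope quotient_scope.

Definition span (K : fieldType) (V : lmodType K) (A : set V) : {pred V} :=
  fun v => `[< exists s : seq (K * V),
     (forall p, p \in s -> A p.2) /\ v = \sum_(p <- s) p.1 *: p.2 >].

Section Span.
Variables (K : fieldType) (V : lmodType K) (A : set V).

Lemma spanP v : reflect (exists s : seq (K * V),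
  (forall p, p \in s -> A p.2) /\ v = \sum_(p <- s) p.1 *: p.2) (v \in span A).
Proof. exact: asboolP. Qed.

Lemma span_closed : subsemimod_closed (span A).
Proof.
split; first split.
- by apply/spanP; exists [::]; rewrite big_nil.
- move=> u v /spanP[s [As ->]] /spanP[t [At ->]].
  apply/spanP; exists (s ++ t); rewrite big_cat; split=> // p.
  by rewrite mem_cat => /orP[/As|/At].
- move=> a v /spanP[s [As ->]]; apply/spanP.
  exists [seq (a * p.1, p.2) | p <- s]; split.
    by move=> _ /mapP[p /As Ap ->].
  by rewrite big_map scaler_sumr; apply: eq_bigr => p _; rewrite scalerA.
Qed.

HB.instance Definition _ := GRing.isSubmodClosed.Build K V (span A) span_closed.

Lemma mem_span v : A v -> v \in span A.
Proof.
move=> Av; apply/spanP; exists [:: (1, v)].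
by split=> [p|]; [rewrite inE => /eqP-> | rewrite big_seq1 scale1r].
Qed.

Lemma span_sub (S : submodClosed V) : (forall v, A v -> v \in S) ->
  forall v, v \in span A -> v \in S.
Proof.
move=> AS v /spanP[s [As ->]]; rewrite big_seq; apply: rpred_sum => p /As Ap.
by apply: rpredZ; apply: AS.
Qed.
End Span.

Section SubOf.
Variables (K : fieldType) (V : lmodType K) (S : submodClosed V).
Definition sub_of := {x : V | x \in S}.
HB.instance Definition _ := SubType.on sub_of.
HB.instance Definition _ := [Choice of sub_of by <:].
HB.instance Definition _ := [SubChoice_isSubLmodule of sub_of by <:].
End SubOf.

Section Quotient.
Variables (K : fieldType) (V : lmodType K) (S : submodClosed V).

(* [submodClosed] does not inherit from [zmodClosed], over which the library
   defines quotients. *)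
Definition zmod_of : {pred V} := fun x => x \in S.
Fact zmod_of_closed : zmod_closed zmod_of.
Proof. exact: GRing.submod_closedB (submodClosedP S). Qed.
HB.instance Definition _ := GRing.isZmodClosed.Build V zmod_of zmod_of_closed.

Definition quotv := Quotient.quot zmod_of.
HB.instance Definition _ := GRing.Zmodule.on quotv.

Definition cls (x : V) : quotv := \pi_(Quotient.quot zmod_of) x.

Lemma clsE x y : (cls x == cls y) = (x - y \in S).
Proof. by rewrite /cls -Quotient.idealrBE. Qed.

Lemma cls_eq0 x : (cls x == 0) = (x \in S).
Proof.
have -> : 0 = cls 0 by rewrite /cls raddf0.
by rewrite clsE subr0.
Qed.

Lemma cls_repr x : cls (repr x) = x.
Proof. exact: reprK. Qed.

Lemma clsD x y : cls (x + y) = cls x + cls y.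
Proof. by rewrite /cls raddfD. Qed.

Definition quotv_scale (a : K) (x : quotv) : quotv := cls (a *: repr x).

Lemma cls_scale a x : quotv_scale a (cls x) = cls (a *: x).
Proof.
by apply/eqP; rewrite clsE -scalerBr rpredZ // -clsE cls_repr.
Qed.

Fact quotv_scaleA a b x :
  quotv_scale a (quotv_scale b x) = quotv_scale (a * b) x.
Proof. by rewrite -[x]cls_repr !cls_scale scalerA. Qed.
Fact quotv_scale1 : left_id 1 quotv_scale.
Proof. by move=> x; rewrite -[x]cls_repr cls_scale scale1r. Qed.
Fact quotv_scaleDr : right_distributive quotv_scale +%R.
Proof.
move=> a x y; rewrite -[x]cls_repr -[y]cls_repr -clsD !cls_scale.
by rewrite scalerDr clsD.
Qed.
Fact quotv_scaleDl x : {morph quotv_scale^~ x : a b / a + b}.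
Proof. by move=> a b; rewrite -[x]cls_repr !cls_scale scalerDl clsD. Qed.

HB.instance Definition _ := GRing.Zmodule_isLmodule.Build K quotv
  quotv_scaleA quotv_scale1 quotv_scaleDr quotv_scaleDl.

Fact cls_linear : linear cls.
Proof. by move=> a x y; rewrite clsD -cls_scale. Qed.
HB.instance Definition _ := GRing.isLinear.Build K V quotv _ cls cls_linear.

End Quotient.

Section LiftQuot.
Variables (K : fieldType) (V W : lmodType K) (S : submodClosed V).
Variables (h : {linear V -> W}) (hS : forall x, x \in S -> h x = 0).

Definition lift_quot of (forall x, x \in S -> h x = 0) :=
  fun x : quotv S => h (repr x).

Lemma lift_quotE x : lift_quot hS (cls S x) = h x.
Proof.
apply/eqP; rewrite -subr_eq0 -linearB; apply/eqP/hS.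
by rewrite -clsE cls_repr.
Qed.

Fact lift_quot_linear : linear (lift_quot hS).
Proof.
move=> a x y; rewrite -[x]cls_repr -[y]cls_repr -linearP !lift_quotE.
exact: linearP.
Qed.
HB.instance Definition _ :=
  GRing.isLinear.Build K (quotv S) W _ (lift_quot hS) lift_quot_linear.
End LiftQuot.

Section Corestr.
Variables (K : fieldType) (V W : lmodType K) (A : submodClosed V) (B : submodClosed W).
Variables (h : {linear V -> W}) (hAB : forall x, x \in A -> h x \in B).

Definition corestr (x : sub_of A) : sub_of B :=
  exist _ (h (val x)) (hAB (valP x)).

Fact corestr_linear : linear corestr.
Proof. by move=> a x y; apply: val_inj; rewrite /= linearP. Qed.
HB.instance Definition _ :=
  GRing.isLinear.Build K (sub_of A) (sub_of B) _ corestr corestr_linear.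
End Corestr.

Section Restr.
Variables (K : fieldType) (V : lmodType K) (A B : submodClosed V).

Definition restr : {pred sub_of A} := fun x => val x \in B.
Lemma restrE x : (x \in restr) = (val x \in B). Proof. by []. Qed.
Fact restr_closed : subsemimod_closed restr.
Proof.
split; first split.
- by rewrite restrE rpred0.
- by move=> x y; rewrite !restrE; apply: rpredD.
- by move=> a x; rewrite !restrE; apply: rpredZ.
Qed.
HB.instance Definition _ :=
  GRing.isSubmodClosed.Build K (sub_of A) restr restr_closed.

End Restr.
Arguments restr {K V} A B x.

Definition tensor_rel (K : fieldType) (U V : lmodType K) :
    set {freeg (U * V) / K} :=
  [set z |
    (exists (a : K) (u u' : U) (v : V),
      z = << (a *: u + u', v) >> - a *: << (u, v) >> - << (u', v) >>) \/
    (exists (a : K) (u : U) (v v' : V),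
      z = << (u, a *: v + v') >> - a *: << (u, v) >> - << (u, v') >>)].

Definition tensor (K : fieldType) (U V : lmodType K) : lmodType K :=
  quotv (span (@tensor_rel K U V)).

Definition tens (K : fieldType) (U V : lmodType K) (u : U) (v : V) :
  tensor U V := cls (span (@tensor_rel K U V)) << (u, v) >>.

Fixpoint tens_pow (K : fieldType) (U V : lmodType K) (c : nat) : lmodType K :=
  if c is k.+1 then tensor (tens_pow U V k) V else U.

(* u (x) v 0 (x) ... (x) v c.-1 *)
Fixpoint pure (K : fieldType) (U V : lmodType K) (c : nat) (u : U)
    (v : nat -> V) : tens_pow U V c :=
  if c is k.+1 return tens_pow U V c then tens (pure k u v) (v k) else u.

Section TensorTheory.
Variables (K : fieldType) (U V : lmodType K).

Lemma tens_linearl (v : V) : linear (fun u : U => tens u v).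
Proof.
move=> a u u'; apply/eqP; rewrite /tens -linearP clsE opprD addrA.
by apply: mem_span; left; exists a, u, u', v.
Qed.

Lemma tens_linearr (u : U) : linear (fun v : V => tens u v).
Proof.
move=> a v v'; apply/eqP; rewrite /tens -linearP clsE opprD addrA.
by apply: mem_span; right; exists a, u, v, v'.
Qed.

Lemma tens_span (t : tensor U V) :
  t \in span [set x | exists (u : U) (v : V), x = tens u v].
Proof.
rewrite -[t]cls_repr; set z := repr t.
rewrite -[z]freeg_sumE linear_sum; apply: rpred_sum => -[u v] _ /=.
have -> : << coeff (u, v) z *g (u, v) >> = coeff (u, v) z *: << (u, v) >>
    :> {freeg (U * V) / K}.
  by apply/eqP/freeg_eqP => w; rewrite coeffZ !coeffU mul1r.
by rewrite linearZ; apply/rpredZ/mem_span; exists u, v.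
Qed.
End TensorTheory.

Section TensorPower.
Variables (K : fieldType) (U V : lmodType K).

Lemma eq_pure c (u : U) (v w : nat -> V) :
  (forall i, (i < c)%N -> v i = w i) -> pure c u v = pure c u w.
Proof.
elim: c => //= c IH vw; rewrite vw // IH // => i ic.
by apply: vw; apply: ltnW.
Qed.

Lemma pure_span c (t : tens_pow U V c) :
  t \in span [set x | exists u v, x = pure c u v].
Proof.
elim: c t => [|c IH] t; first by apply: mem_span; exists t, (fun=> 0).
pose P := span [set x | exists (u : U) (v : nat -> V), x = pure c.+1 u v].
have : forall x, x \in span [set x | exists (u : tens_pow U V c) (v : V),
    x = tens u v] -> x \in P.
  2: by move/(_ t (tens_span (t : tensor (tens_pow U V c) V))).
apply: span_sub => _ [t' [v ->]].
have /spanP[s [sP ->]] := IH t'.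
pose lin := GRing.isLinear.Build K _ _ _ _ (tens_linearl (U := tens_pow U V c) v).
have [h hE] : exists h : {linear tens_pow U V c -> tensor (tens_pow U V c) V},
  forall u, h u = tens u v.
  pose h : {linear tens_pow U V c -> tensor (tens_pow U V c) V} :=
    HB.pack (fun u : tens_pow U V c => tens u v) lin.
  by exists h.
rewrite -hE linear_sum big_seq; apply: rpred_sum => p /sP[u [w pE]].
rewrite linearZ /= hE; apply/rpredZ/mem_span.
exists u, (fun i => if i == c then v else w i); rewrite /= eqxx pE.
by congr tens; apply: eq_pure => i; case: eqP => // ->; rewrite ltnn.
Qed.
End TensorPower.

HB.mixin Record Lmodule_isLeibniz (K : fieldType) (L : Type)
    of GRing.Lmodule K L := {
  lbr : L -> L -> L;
  lbr_linearl : forall y, linear (lbr^~ y);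
  lbr_linearr : forall x, linear (lbr x);
  lbr_leibniz : forall x y z,
    lbr x (lbr y z) = lbr (lbr x y) z - lbr (lbr x z) y
}.

#[short(type="leibnizType")]
HB.structure Definition Leibniz (K : fieldType) :=
  {L of GRing.Lmodule K L & Lmodule_isLeibniz K L}.

(* [x, y]_Lie *)
Definition lieb (K : fieldType) (L : leibnizType K) (x y : L) : L :=
  lbr x y + lbr y x.

Section LeibnizTheory.
Variables (K : fieldType) (L : leibnizType K).
Implicit Types x y z : L.

Lemma lbrDl x y z : lbr (x + y) z = lbr x z + lbr y z.
Proof. by have := lbr_linearl z 1 x y; rewrite !scale1r. Qed.
Lemma lbrDr x y z : lbr x (y + z) = lbr x y + lbr x z.
Proof. by have := lbr_linearr x 1 y z; rewrite !scale1r. Qed.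
Lemma lbr0l x : lbr 0 x = 0.
Proof. by apply: (addrI (lbr 0 x)); rewrite -lbrDl !addr0. Qed.
Lemma lbr0r x : lbr x 0 = 0.
Proof. by apply: (addrI (lbr x 0)); rewrite -lbrDr !addr0. Qed.
Lemma lbrZl a x y : lbr (a *: x) y = a *: lbr x y.
Proof. by have := lbr_linearl y a x 0; rewrite lbr0l !addr0. Qed.
Lemma lbrZr a x y : lbr x (a *: y) = a *: lbr x y.
Proof. by have := lbr_linearr x a y 0; rewrite lbr0r !addr0. Qed.
Lemma lbrNl x y : lbr (- x) y = - lbr x y.
Proof. by rewrite -scaleN1r lbrZl scaleN1r. Qed.
Lemma lbrNr x y : lbr x (- y) = - lbr x y.
Proof. by rewrite -scaleN1r lbrZr scaleN1r. Qed.
Lemma lbr_suml (I : Type) (r : seq I) (F : I -> L) x :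
  lbr (\sum_(i <- r) F i) x = \sum_(i <- r) lbr (F i) x.
Proof. by elim/big_rec2: _ => [|i u v _ <-]; rewrite ?lbr0l ?lbrDl. Qed.
Lemma lbr_sumr (I : Type) (r : seq I) (F : I -> L) x :
  lbr x (\sum_(i <- r) F i) = \sum_(i <- r) lbr x (F i).
Proof. by elim/big_rec2: _ => [|i u v _ <-]; rewrite ?lbr0r ?lbrDr. Qed.

Lemma lbr_lieb x y z : lbr x (lieb y z) = 0.
Proof. by rewrite lbrDr !lbr_leibniz addrA subrK subrr. Qed.

Lemma lieb_lbr x y z :
  lbr (lieb x y) z = lieb (lbr x z) y + lieb x (lbr y z).
Proof.
rewrite /lieb lbrDl [lbr y (lbr x z)]lbr_leibniz [lbr x (lbr y z)]lbr_leibniz.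
set a := lbr (lbr x z) y; set b := lbr (lbr x y) z.
by rewrite addrACA [a + _]addrC !subrK addrC.
Qed.

Lemma lbr_sq x y : lbr x (lbr y y) = 0.
Proof. by rewrite lbr_leibniz subrr. Qed.

Lemma sq_lbr x y : lbr (lbr x x) y =
  lbr (x + lbr x y) (x + lbr x y) - lbr x x - lbr (lbr x y) (lbr x y).
Proof.
rewrite lbrDl !lbrDr [lbr x (lbr x y)]lbr_leibniz.
set a := lbr x x; set b := lbr (lbr x y) x; set d := lbr (lbr x y) _.
set e := lbr a y.
by rewrite !addrA subrK [a + e]addrC -(addrA e a d) -(addrA _ (- a)) -opprD addrK.
Qed.
End LeibnizTheory.

(* Two-sided ideals. *)
HB.mixin Record isLeibnizIdeal (K : fieldType) (L : leibnizType K)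
    (I : L -> bool) := {
  ideal_lbrl : forall x y, x \in (I : {pred L}) -> lbr x y \in (I : {pred L});
  ideal_lbrr : forall x y, y \in (I : {pred L}) -> lbr x y \in (I : {pred L})
}.

#[short(type="leibnizIdeal")]
HB.structure Definition LeibnizIdeal (K : fieldType) (L : leibnizType K) :=
  {I of @GRing.SubmodClosed K L I & isLeibnizIdeal K L I}.

HB.mixin Record isLeibnizMorphism (K : fieldType) (L M : leibnizType K)
    (f : L -> M) := {
  lmorph_lbr : {morph f : x y / lbr x y}
}.

HB.structure Definition LeibnizMorphism (K : fieldType) (L M : leibnizType K) :=
  {f of @GRing.Linear K L M *:%R f & isLeibnizMorphism K L M f}.

Notation "{ 'leibniz' L -> M }" := (LeibnizMorphism.type L M)
  (at level 0, L at level 98, M at level 99, format "{ 'leibniz'  L  ->  M }")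
  : type_scope.

Lemma lmorph_lieb (K : fieldType) (L M : leibnizType K) (f : {leibniz L -> M}) :
  {morph f : x y / lieb x y}.
Proof. by move=> x y; rewrite /lieb raddfD /= !lmorph_lbr. Qed.

Section Morphisms.
Variables (K : fieldType) (L M N : leibnizType K).

Fact id_lbr : {morph (@idfun L) : x y / lbr x y}.
Proof. by []. Qed.
HB.instance Definition _ := isLeibnizMorphism.Build K L L idfun id_lbr.

Variables (f : {leibniz M -> N}) (h : {leibniz L -> M}).
Fact comp_lbr : {morph f \o h : x y / lbr x y}.
Proof. by move=> x y; rewrite /= !lmorph_lbr. Qed.
HB.instance Definition _ := isLeibnizMorphism.Build K L N (f \o h) comp_lbr.

Definition kernel : {pred L} := fun x => h x == 0.
Lemma kernelE x : (x \in kernel) = (h x == 0). Proof. by []. Qed.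
Fact kernel_closed : subsemimod_closed kernel.
Proof.
split; first split.
- by rewrite kernelE raddf0.
- by move=> x y; rewrite !kernelE raddfD /= => /eqP-> /eqP->; rewrite addr0.
- by move=> a x; rewrite !kernelE linearZ /= => /eqP->; rewrite scaler0.
Qed.
HB.instance Definition _ := GRing.isSubmodClosed.Build K L kernel kernel_closed.
Fact kernel_lbrl x y : x \in kernel -> lbr x y \in kernel.
Proof. by rewrite !kernelE lmorph_lbr /= => /eqP->; rewrite lbr0l. Qed.
Fact kernel_lbrr x y : y \in kernel -> lbr x y \in kernel.
Proof. by rewrite !kernelE lmorph_lbr /= => /eqP->; rewrite lbr0r. Qed.
HB.instance Definition _ :=
  isLeibnizIdeal.Build K L kernel kernel_lbrl kernel_lbrr.
End Morphisms.

Section Ideals.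
Variables (K : fieldType) (L : leibnizType K).

Definition full : {pred L} := predT.
Fact full_closed : subsemimod_closed full.
Proof. by []. Qed.
HB.instance Definition _ := GRing.isSubmodClosed.Build K L full full_closed.
Fact full_lbrl x y : x \in full -> lbr x y \in full. Proof. by []. Qed.
Fact full_lbrr x y : y \in full -> lbr x y \in full. Proof. by []. Qed.
HB.instance Definition _ := isLeibnizIdeal.Build K L full full_lbrl full_lbrr.

Definition ann : {pred L} := span [set z | exists x : L, z = lbr x x].
HB.instance Definition _ := GRing.SubmodClosed.on ann.
Fact ann_lbrl x y : x \in ann -> lbr x y \in ann.
Proof.
move=> /spanP[s [sq ->]]; rewrite lbr_suml big_seq; apply: rpred_sum => p.
move=> /sq[z pE]; rewrite lbrZl; apply: rpredZ; rewrite pE sq_lbr.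
have sqann w : lbr w w \in ann by apply: mem_span; exists w.
by rewrite -!scaleN1r !rpredD ?rpredZ.
Qed.
Fact ann_lbrr x y : y \in ann -> lbr x y \in ann.
Proof.
move=> /spanP[s [sq ->]]; rewrite lbr_sumr big_seq; apply: rpred_sum => p.
by move=> /sq[z pE]; rewrite lbrZr pE lbr_sq scaler0 rpred0.
Qed.
HB.instance Definition _ := isLeibnizIdeal.Build K L ann ann_lbrl ann_lbrr.

Variables A B : leibnizIdeal L.

Definition capI : {pred L} := [predI A & B].
Lemma capIE x : (x \in capI) = (x \in A) && (x \in B). Proof. by []. Qed.
Fact capI_closed : subsemimod_closed capI.
Proof.
split; first split.
- by rewrite capIE !rpred0.
- move=> x y; rewrite !capIE => /andP[Ax Bx] /andP[Ay By].
  by rewrite !rpredD.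
- by move=> a x; rewrite !capIE => /andP[Ax Bx]; rewrite !rpredZ.
Qed.
HB.instance Definition _ := GRing.isSubmodClosed.Build K L capI capI_closed.
Fact capI_lbrl x y : x \in capI -> lbr x y \in capI.
Proof. by rewrite !capIE => /andP[Ax Bx]; rewrite !ideal_lbrl. Qed.
Fact capI_lbrr x y : y \in capI -> lbr x y \in capI.
Proof. by rewrite !capIE => /andP[Ax Bx]; rewrite !ideal_lbrr. Qed.
HB.instance Definition _ := isLeibnizIdeal.Build K L capI capI_lbrl capI_lbrr.

Definition lie_comm : {pred L} :=
  span [set z | exists a b : L, [/\ a \in A, b \in B & z = lieb a b]].
HB.instance Definition _ := GRing.SubmodClosed.on lie_comm.
Lemma mem_lie_comm a b : a \in A -> b \in B -> lieb a b \in lie_comm.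
Proof. by move=> Aa Bb; apply: mem_span; exists a, b. Qed.
Fact lie_comm_lbrl x y : x \in lie_comm -> lbr x y \in lie_comm.
Proof.
move=> /spanP[s [sC ->]]; rewrite lbr_suml big_seq; apply: rpred_sum => p.
move=> /sC[a [b [Aa Bb pE]]]; rewrite lbrZl; apply: rpredZ.
by rewrite pE lieb_lbr rpredD // mem_lie_comm // ideal_lbrl.
Qed.
Fact lie_comm_lbrr x y : y \in lie_comm -> lbr x y \in lie_comm.
Proof.
move=> /spanP[s [sC ->]]; rewrite lbr_sumr big_seq; apply: rpred_sum => p.
move=> /sC[a [b [Aa Bb pE]]].
by rewrite lbrZr pE lbr_lieb scaler0 rpred0.
Qed.
HB.instance Definition _ :=
  isLeibnizIdeal.Build K L lie_comm lie_comm_lbrl lie_comm_lbrr.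
End Ideals.
Arguments full {K L}.
Arguments ann {K} L.

Section LeibnizQuotient.
Variables (K : fieldType) (L : leibnizType K) (I : leibnizIdeal L).

Definition lquot := quotv I.
HB.instance Definition _ := GRing.Lmodule.on lquot.

Definition lproj (x : L) : lquot := cls I x.
HB.instance Definition _ :=
  GRing.isLinear.Build K L lquot _ lproj (@cls_linear K L I).

Definition lquot_br (x y : lquot) : lquot := lproj (lbr (repr x) (repr y)).

Lemma lproj_br x y : lquot_br (lproj x) (lproj y) = lproj (lbr x y).
Proof.
apply/eqP; rewrite /lquot_br /lproj clsE.
set x' := repr _; set y' := repr _.
have Ix : x' - x \in I by rewrite -clsE cls_repr.
have Iy : y' - y \in I by rewrite -clsE cls_repr.
have -> : lbr x' y' - lbr x y = lbr (x' - x) y' + lbr x (y' - y).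
  by rewrite lbrDl lbrDr lbrNl lbrNr addrA subrK.
by apply: rpredD; [exact: ideal_lbrl | exact: ideal_lbrr].
Qed.

Lemma lproj_repr x : lproj (repr x) = x. Proof. exact: cls_repr. Qed.

Fact lquot_linearl y : linear (lquot_br^~ y).
Proof.
move=> a u v; rewrite -[y]lproj_repr -[u]lproj_repr -[v]lproj_repr.
by rewrite -linearP !lproj_br lbr_linearl linearP.
Qed.
Fact lquot_linearr x : linear (lquot_br x).
Proof.
move=> a u v; rewrite -[x]lproj_repr -[u]lproj_repr -[v]lproj_repr.
by rewrite -linearP !lproj_br lbr_linearr linearP.
Qed.
Fact lquot_leibniz x y z : lquot_br x (lquot_br y z) =
  lquot_br (lquot_br x y) z - lquot_br (lquot_br x z) y.
Proof.
rewrite -[x]lproj_repr -[y]lproj_repr -[z]lproj_repr.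
by rewrite !lproj_br lbr_leibniz raddfB.
Qed.
HB.instance Definition _ := Lmodule_isLeibniz.Build K lquot
  lquot_linearl lquot_linearr lquot_leibniz.

Fact lproj_lbr : {morph lproj : x y / lbr x y}.
Proof. by move=> x y; rewrite -lproj_br. Qed.
HB.instance Definition _ := isLeibnizMorphism.Build K L lquot lproj lproj_lbr.
End LeibnizQuotient.

(* [gamma N i] is gamma_i^Lie(L, N); the index starts at 1, and
   [gamma N 0 = N] is a junk value. *)
Definition gamma (K : fieldType) (L : leibnizType K) (N : leibnizIdeal L)
    (i : nat) : leibnizIdeal L :=
  iter i.-1 (fun A : leibnizIdeal L => lie_comm A full) N.

(* [ ... [[x, y 0]_Lie, y 1]_Lie, ..., y c.-1]_Lie *)
Fixpoint lieb_iter (K : fieldType) (L : leibnizType K) (c : nat) (x : L)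
    (y : nat -> L) : L :=
  if c is k.+1 then lieb (lieb_iter k x y) (y k) else x.

Section GammaTheory.
Variables (K : fieldType) (L M : leibnizType K).

Lemma gammaS (N : leibnizIdeal L) i : gamma N i.+2 = lie_comm (gamma N i.+1) full.
Proof. by []. Qed.

Lemma gamma_morph (h : {leibniz L -> M}) (A : leibnizIdeal L)
    (B : leibnizIdeal M) i :
    (forall x, x \in A -> h x \in B) ->
  forall x, x \in gamma A i -> h x \in gamma B i.
Proof.
case: i => // i hAB; elim: i => // i IH x; rewrite !gammaS.
move=> /spanP[s [sC ->]]; rewrite linear_sum big_seq; apply: rpred_sum => p.
move=> /sC[a [b [Aa _ pE]]]; rewrite linearZ pE /= lmorph_lieb rpredZ //.
by apply: mem_lie_comm => //; apply: IH.
Qed.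

Lemma gamma_sub (A B : leibnizIdeal L) i : (forall x, x \in A -> x \in B) ->
  forall x, x \in gamma A i -> x \in gamma B i.
Proof.
case: i => // i AB; elim: i => // i IH x; rewrite !gammaS.
move=> /spanP[s [sC ->]]; rewrite big_seq; apply: rpred_sum => p.
move=> /sC[a [b [Aa _ ->]]]; apply/rpredZ/mem_lie_comm => //; exact: IH.
Qed.

Lemma gamma_subl (A : leibnizIdeal L) i x : x \in gamma A i -> x \in A.
Proof.
case: i => // i; elim: i x => // i IH x; rewrite gammaS.
move=> /spanP[s [sC ->]]; rewrite big_seq; apply: rpred_sum => p.
move=> /sC[a [b [/IH Aa _ ->]]]; apply/rpredZ.
by apply: rpredD; [exact: ideal_lbrl | exact: ideal_lbrr].
Qed.

Lemma lieb_iter_gamma (A : leibnizIdeal L) c x y :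
  x \in A -> lieb_iter c x y \in gamma A c.+1.
Proof. by move=> Ax; elim: c => // c IH; apply: mem_lie_comm. Qed.
End GammaTheory.

Definition free_leibniz (K : fieldType) (F : leibnizType K) : Prop :=
  exists (X : Type) (i : X -> F), forall (L : leibnizType K) (phi : X -> L),
    (exists h : {leibniz F -> L}, forall x, h (i x) = phi x) /\
    (forall h h' : {leibniz F -> L}, (forall x, h (i x) = phi x) ->
       (forall x, h' (i x) = phi x) -> h =1 h').

Definition g_Lie (K : fieldType) (L : leibnizType K) : leibnizType K :=
  lquot (ann L).

Section Multiplier.
Variables (K : fieldType) (F : leibnizType K) (c : nat).

Lemma gamma_sub_cap (R : leibnizIdeal F) x :
  x \in gamma R c.+1 -> x \in capI R (gamma full c.+1).
Proof.
move=> gx; rewrite capIE (gamma_subl gx) /=.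
exact: (gamma_sub (A := R) (B := full)) gx.
Qed.

(* (R :&: gamma_{c+1}(F)) / gamma_{c+1}(F, R), for F --> F/R a free
   presentation *)
Definition mult (R : leibnizIdeal F) : lmodType K :=
  quotv (restr (capI R (gamma full c.+1)) (gamma R c.+1)).

Definition mult_cls (R : leibnizIdeal F) :
    {linear sub_of (capI R (gamma full c.+1)) -> mult R} :=
  cls (restr (capI R (gamma full c.+1)) (gamma R c.+1)).

Variables (R S : leibnizIdeal F) (RS : forall x, x \in R -> x \in S).

Fact mult_map_mem x :
  x \in capI R (gamma full c.+1) -> idfun x \in capI S (gamma full c.+1).
Proof. by rewrite !capIE => /andP[/RS-> ->]. Qed.

Fact mult_map_wd x : x \in restr (capI R (gamma full c.+1)) (gamma R c.+1) ->
  (mult_cls S \o corestr mult_map_mem) x = 0.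
Proof.
by rewrite restrE => Rx; apply/eqP; rewrite cls_eq0 restrE; apply: gamma_sub Rx.
Qed.

Definition mult_map : {linear mult R -> mult S} := lift_quot mult_map_wd.

Lemma mult_mapE x : mult_map (mult_cls R x) = mult_cls S (corestr mult_map_mem x).
Proof. exact: lift_quotE. Qed.
End Multiplier.

Section Extension.
Variables (K : fieldType) (g q : leibnizType K) (pi : {leibniz g -> q}) (c : nat).

Definition lie_central : Prop :=
  forall x, x \in gamma (kernel pi) c.+1 -> x = 0.

Definition lie_stem : Prop :=
  lie_central /\ (forall x, x \in kernel pi -> x \in gamma (@full K g) c.+1).

Definition ker_to_quot : sub_of (kernel pi) -> lquot (gamma (@full K g) c.+1) :=
  fun x => lproj (gamma full c.+1) (val x).

Fact quot_map_wd x : x \in gamma (@full K g) c.+1 ->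
  (lproj (gamma (@full K q) c.+1) \o pi) x = 0.
Proof.
move=> gx; apply/eqP; rewrite cls_eq0.
exact: (gamma_morph (A := full) (B := full)) gx.
Qed.

Definition quot_map :
    lquot (gamma (@full K g) c.+1) -> lquot (gamma (@full K q) c.+1) :=
  lift_quot quot_map_wd.

Lemma quot_mapE x : quot_map (lproj _ x) = lproj _ (pi x).
Proof. exact: lift_quotE. Qed.

Fact quot_map_linear : linear quot_map.
Proof. exact: lift_quot_linear. Qed.
HB.instance Definition _ := GRing.isLinear.Build K
  (lquot (gamma (@full K g) c.+1)) (lquot (gamma (@full K q) c.+1)) _
  quot_map quot_map_linear.
Fact quot_map_lbr : {morph quot_map : x y / lbr x y}.
Proof.
move=> x y; rewrite -[x]lproj_repr -[y]lproj_repr -lmorph_lbr !quot_mapE.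
by rewrite !lmorph_lbr.
Qed.
HB.instance Definition _ := isLeibnizMorphism.Build K
  (lquot (gamma (@full K g) c.+1)) (lquot (gamma (@full K q) c.+1))
  quot_map quot_map_lbr.

Variables (f : leibnizType K) (rho : {leibniz f -> g}).
Hypothesis central : lie_central.

Let r : leibnizIdeal f := kernel rho.
Let s : leibnizIdeal f := kernel (pi \o rho).
Let n : leibnizIdeal g := kernel pi.

Fact ker_comp x : x \in kernel rho -> x \in kernel (pi \o rho).
Proof. by rewrite !kernelE /= => /eqP->; rewrite raddf0. Qed.

Fact rho_ker x : x \in kernel (pi \o rho) -> rho x \in kernel pi.
Proof. by []. Qed.

Fact theta_mem x : x \in capI s (gamma full c.+1) -> rho x \in n.
Proof. by rewrite capIE => /andP[/rho_ker]. Qed.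

Fact theta_wd x : x \in restr (capI s (gamma full c.+1)) (gamma s c.+1) ->
  corestr theta_mem x = 0.
Proof.
rewrite restrE => gx; apply/val_inj/central.
exact: (gamma_morph (A := s) (B := n)) gx.
Qed.

Definition theta : {linear mult c s -> sub_of n} := lift_quot theta_wd.

Lemma thetaE x : val (theta (mult_cls c s x)) = rho (val x).
Proof. exact: (congr1 val (lift_quotE theta_wd x)). Qed.

Fact lieb_iter_mem (x : sub_of s) (y : nat -> f) :
  lieb_iter c (val x) y \in capI r (gamma full c.+1).
Proof.
have gx := lieb_iter_gamma c y (valP x).
have := gamma_sub_cap gx; rewrite !capIE => /andP[_ ->]; rewrite andbT kernelE.
apply/eqP/central; exact: (gamma_morph (A := s) (B := n)) gx.
Qed.

Definition ganea_val (x : sub_of s) (y : nat -> f) : mult c r :=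
  mult_cls c r (exist _ (lieb_iter c (val x) y) (lieb_iter_mem x y)).

Definition ganea_tens (x : sub_of s) (y : nat -> f) :
    tens_pow (sub_of n) (g_Lie g) c :=
  pure c (corestr rho_ker x) (fun i => lproj (ann g) (rho (y i))).

(* The assignment [ganea_tens x y |-> ganea_val x y] does not always descend to
   a linear map on n (x) g_Lie^(x)c: the value may depend on the choice of the
   y i over given classes in g_Lie. For c = 1, let f be free on a and e, s the
   ideal of e and r the ideal generated by [s, f]_Lie; the class of [a, a] in
   g_Lie is 0, but [e, [a, a]]_Lie = [[a, a], e] is not in [r, f]_Lie. For
   c >= 2 the value may already change when y 1 varies by an element of r.
   The arrow is therefore taken to be the linear relation spanned by the
   prescribed pairs; by [ganea_relP] below it is the graph of the linear map
   with the prescribed values whenever that map exists. *)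
Definition ganea_rel
    (t : tens_pow (sub_of n) (g_Lie g) c) (m : mult c r) : Prop :=
  (t, m) \in span [set p | exists x y, p = (ganea_tens x y, ganea_val x y)].

Lemma ganea_relP
    (tau : {linear tens_pow (sub_of n) (g_Lie g) c -> mult c r}) t m :
    (forall y, exists x, rho x = y) ->
    (forall x y, tau (ganea_tens x y) = ganea_val x y) ->
  ganea_rel t m <-> tau t = m.
Proof.
move=> rho_surj tauE; split=> [/spanP[l [lP]]|<-].
  move=> tmE; have -> : t = \sum_(p <- l) p.1 *: p.2.1.
    by have /(congr1 fst) /= := tmE; rewrite (raddf_sum fst).
  have -> : m = \sum_(p <- l) p.1 *: p.2.2.
    by have /(congr1 snd) /= := tmE; rewrite (raddf_sum snd).
  rewrite linear_sum !big_seq; apply: eq_bigr => p /lP[x [y ->]] /=.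
  by rewrite linearZ /= tauE.
have /spanP[l [lP ->]] := pure_span t.
rewrite /ganea_rel linear_sum.
have -> : (\sum_(p <- l) p.1 *: p.2, \sum_(p <- l) tau (p.1 *: p.2)) =
    \sum_(p <- l) p.1 *: (p.2, tau p.2).
  rewrite [RHS]surjective_pairing (raddf_sum fst) (raddf_sum snd) /=.
  by congr pair; apply: eq_bigr => p _; rewrite linearZ.
rewrite big_seq; apply: rpred_sum => p /lP[u [v ->]].
apply/rpredZ/mem_span.
have [x xu] := rho_surj (val u).
have sx : x \in s by rewrite kernelE /= xu; exact: (valP u).
have /choice[y yE] i : exists y, rho y = repr (v i) by exact: rho_surj.
exists (exist _ x sx), y; rewrite -tauE.
suff -> : pure c u v = ganea_tens (exist _ x sx) y by [].
rewrite /ganea_tens; congr pure; first exact: val_inj.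
by apply/funext => i; rewrite yE lproj_repr.
Qed.

(* n (x) g_Lie^(x)c -> M(g) -> M(q) -> n -> 0 is exact *)
Definition ganea_exact : Prop :=
  [/\ forall m : mult c r,
        mult_map c ker_comp m = 0 <-> exists t, ganea_rel t m,
      forall m : mult c s,
        theta m = 0 <-> exists m', mult_map c ker_comp m' = m
    & forall x : sub_of n, exists m, theta m = x].
End Extension.
Arguments ker_to_quot {K g q} pi c x.
Arguments quot_map {K g q} pi c _.

(* Main.v *)
Require Import Defs.
From HB Require Import structures.
From mathcomp Require Import all_boot all_order all_algebra.
From mathcomp Require Import boolp classical_sets.
Set Implicit Arguments.
Unset Strict Implicit.

Import GRing.Theory.
Local Open Scope ring_scope.

(** Conditions (a), (b), (c) and (e) all say that n lies in gamma_{c+1}(g),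
because a surjective morphism maps gamma_{c+1} onto gamma_{c+1}.
In (d), only the surjectivity of theta depends on the extension being stem:
gamma_{c+1}(f, s) is spanned by the iterated brackets [...[x, y_1], ..., y_c]
with x in s, and lies in r by c-Lie-centrality, so its image in M(g) is at the
same time the kernel of M(g) -> M(q) and the image of the first arrow;
exactness at M(q) only says that x in s is killed by rho iff x is in r. *)

Section Gamma.
Variables (K : fieldType) (L M : leibnizType K).

Lemma lieb_suml (I : Type) (r : seq I) (F : I -> L) x :
  lieb (\sum_(i <- r) F i) x = \sum_(i <- r) lieb (F i) x.
Proof. by rewrite /lieb lbr_suml lbr_sumr -big_split. Qed.

Lemma liebZl a (x y : L) : lieb (a *: x) y = a *: lieb x y.
Proof. by rewrite /lieb lbrZl lbrZr scalerDr. Qed.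

Lemma eq_lieb_iter c (x : L) (y z : nat -> L) :
  (forall i, (i < c)%N -> y i = z i) -> lieb_iter c x y = lieb_iter c x z.
Proof.
elim: c => //= c IH yz; rewrite yz // IH // => i ic.
by apply: yz; apply: ltnW.
Qed.

(** The bracket [lieb] is linear in its first argument, so expanding that argument by induction
    turns each generator into a combination of iterated brackets. *)
Lemma gamma_span (A : leibnizIdeal L) c x : x \in gamma A c.+1 ->
  x \in Defs.span [set z | exists a y, a \in A /\ z = lieb_iter c a y]%classic.
Proof.
elim: c x => [|c IH] x; first by move=> Ax; apply: mem_span; exists x, (fun=> 0).
rewrite gammaS; apply: Defs.span_sub => _ [a [b [/IH/spanP[s [sP ->]] _ ->]]].
rewrite lieb_suml big_seq; apply: rpred_sum => p /sP[u [y [Au pE]]].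
rewrite liebZl; apply/rpredZ/mem_span.
(* The inner bracket reads only the indices below [c], so index [c] is free to hold the new factor
   [b]. *)
exists u, (fun i => if i == c then b else y i); split=> //=.
rewrite eqxx pE; congr lieb; apply: eq_lieb_iter => i.
by case: eqP => // ->; rewrite ltnn.
Qed.

(** Both arguments of a generator lift, the first by induction inside [gamma] and the second by
    surjectivity; a second induction adds up the lifts along the linear combination. *)
Lemma gamma_surj (h : {leibniz L -> M}) i :
    (forall y, exists x, h x = y) ->
  forall y, y \in gamma full i -> exists2 x, x \in gamma full i & h x = y.
Proof.
move=> h_surj; case: i => [|i] y.
  by have [x <-] := h_surj y; exists x.
elim: i y => [|i IH] y; first by have [x <-] := h_surj y; exists x.
rewrite !gammaS => /spanP[s [sP ->]].
elim: s sP => [_|p s IHs sP].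
  by exists 0; rewrite ?rpred0 // big_nil raddf0.
have [|x gx xE] := IHs; first by move=> r rs; apply: sP; rewrite inE rs orbT.
have [|a [b [/IH[a' ga' <-] _ pE]]] := sP p; first exact: mem_head.
have [b' b'E] := h_surj b.
exists (p.1 *: lieb a' b' + x).
  by rewrite rpredD ?rpredZ // mem_lie_comm.
by rewrite big_cons linearD linearZ /= lmorph_lieb b'E xE pE.
Qed.
End Gamma.

Lemma mult_cls_surj (K : fieldType) (F : leibnizType K) c (R : leibnizIdeal F)
  (m : mult c R) : exists x, mult_cls c R x = m.
Proof. by exists (repr m); apply: cls_repr. Qed.

Section Extension.
Variables (K : fieldType) (g q : leibnizType K) (pi : {leibniz g -> q}) (c : nat).

Lemma ker_to_quot_eq0 x :
  ker_to_quot pi c x = 0 <-> val x \in gamma (@full K g) c.+1.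
Proof. by rewrite -cls_eq0; split=> [xE|/eqP]; [apply/eqP|]. Qed.

Lemma quot_map_bij : (forall y, exists x, pi x = y) ->
  bijective (quot_map pi c) <->
  forall x, x \in kernel pi -> x \in gamma (@full K g) c.+1.
Proof.
move=> pi_surj; split=> [/bij_inj inj x|ng].
  rewrite kernelE => /eqP xE; rewrite -cls_eq0; apply/eqP.
  apply: (inj (lproj _ x) 0); rewrite raddf0.
  by rewrite quot_mapE xE raddf0.
have inj : injective (quot_map pi c).
  apply: raddf_inj => x; rewrite -[x]lproj_repr /= quot_mapE => /eqP.
  (* A lift [y] of the image, taken inside [gamma], differs from the representative by an element of
     the kernel. *)
  rewrite cls_eq0 => /(gamma_surj pi_surj)[y gy yE].
  apply/eqP; rewrite cls_eq0 -[repr x](subrK y) rpredD // ng //.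
  by rewrite kernelE raddfB /= yE subrr.
have /choice[inv invK] y : exists x, quot_map pi c x = y.
  have [x xE] := pi_surj (repr y); exists (lproj _ x).
  by rewrite quot_mapE xE lproj_repr.
by exists inv => // x; apply: inj.
Qed.

Variables (f : leibnizType K) (rho : {leibniz f -> g}).
Hypothesis central : lie_central pi c.

(** The image of [theta] is the intersection of the kernel of [pi] with [gamma full c.+1], since
    [rho] maps [gamma] of [f] onto [gamma] of [g]. *)
Lemma theta_surj : (forall y, exists x, rho x = y) ->
  (forall x : sub_of (kernel pi), exists m, theta rho central m = x) <->
  forall x, x \in kernel pi -> x \in gamma (@full K g) c.+1.
Proof.
move=> rho_surj; split=> [surj x nx|ng x].
  have [m mE] := surj (exist _ x nx); have [z zE] := mult_cls_surj m.
  have <- : rho (val z) = x by rewrite -(thetaE central) zE mE.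
  have := valP z.
  by rewrite capIE => /andP[_]; apply: gamma_morph.
have [z gz zE] := gamma_surj rho_surj (ng _ (valP x)).
have sz : z \in capI (kernel (pi \o rho)) (gamma full c.+1).
  by rewrite capIE gz andbT kernelE /= zE; apply: (valP x).
by exists (mult_cls c _ (exist _ z sz)); apply: val_inj; rewrite thetaE.
Qed.

Lemma mult_map_eq0 (x : sub_of (capI (kernel rho) (gamma full c.+1))) :
  mult_map c (@ker_comp _ _ _ pi _ rho) (mult_cls c (kernel rho) x) = 0 <->
  val x \in gamma (kernel (pi \o rho)) c.+1.
Proof.
by rewrite mult_mapE; split=> [/eqP|gx]; last apply/eqP; rewrite cls_eq0 restrE.
Qed.

Lemma mult_map_ganea_val x y :
  mult_map c (@ker_comp _ _ _ pi _ rho) (ganea_val central x y) = 0.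
Proof. by apply/mult_map_eq0/lieb_iter_gamma/(valP x). Qed.

(** Each term of the expansion of [x] into iterated brackets is, up to its scalar, a prescribed
    value of the first arrow. *)
Lemma ganea_rel_cls (x : sub_of (capI (kernel rho) (gamma full c.+1))) :
  val x \in gamma (kernel (pi \o rho)) c.+1 ->
  exists t, ganea_rel central t (mult_cls c (kernel rho) x).
Proof.
move=> /gamma_span/spanP[l [lP xE]]; elim: l x xE lP => [|p l IH] x xE lP.
  have -> : x = 0 by apply: val_inj; rewrite xE big_nil.
  by exists 0; rewrite raddf0; apply: (rpred0 (Defs.span _)).
have [|a [y [sa pE]]] := lP p; first exact: mem_head.
pose a' : sub_of (kernel (pi \o rho)) := exist _ a sa.
(* By centrality each single bracket lies in the kernel of [rho], so [x - p.1 *: z] stays in the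
   domain of [mult_cls] and the induction applies to it. *)
pose z : sub_of (capI (kernel rho) (gamma full c.+1)) :=
  exist _ (lieb_iter c a y) (lieb_iter_mem central a' y).
have [||t tE] := IH (x - p.1 *: z).
- by rewrite raddfB linearZ /= xE big_cons pE scalerN addrC addKr.
- by move=> r rl; apply: lP; rewrite inE rl orbT.
exists (p.1 *: ganea_tens c a' y + t).
have -> : mult_cls c (kernel rho) x =
    p.1 *: ganea_val central a' y + mult_cls c (kernel rho) (x - p.1 *: z).
  by rewrite -linearP addrC subrK.
have ayR : ganea_rel central (ganea_tens c a' y) (ganea_val central a' y).
  by apply: Defs.mem_span; exists a', y.
exact: rpredD (rpredZ p.1 ayR) tE.
Qed.

Lemma mult_map_ker_ganea (m : mult c (kernel rho)) :
  mult_map c (@ker_comp _ _ _ pi _ rho) m = 0 <->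
  exists t, ganea_rel central t m.
Proof.
split=> [|[t /spanP[l [lP tmE]]]].
  by have [x <-] := mult_cls_surj m => /mult_map_eq0; apply: ganea_rel_cls.
have -> : m = \sum_(p <- l) p.1 *: p.2.2.
  by have /(congr1 snd) /= := tmE; rewrite (raddf_sum snd).
rewrite linear_sum big_seq big1 // => p /lP[x [y ->]].
rewrite linearZ -(scaler0 _ p.1); congr (_ *: _).
exact: mult_map_ganea_val.
Qed.

Lemma theta_ker_mult_map (m : mult c (kernel (pi \o rho))) :
  theta rho central m = 0 <->
  exists m', mult_map c (@ker_comp _ _ _ pi _ rho) m' = m.
Proof.
split=> [|[m' <-]].
  have [x <-] := mult_cls_surj m => /(congr1 val); rewrite thetaE => xE.
  (* The same element of [f] represents the preimage. *)
  have rx : val x \in capI (kernel rho) (gamma full c.+1).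
    have := valP x; rewrite !capIE => /andP[_ ->].
    by rewrite andbT kernelE xE /=.
  exists (mult_cls c _ (exist _ (val x) rx)); rewrite mult_mapE.
  by congr (cls _ _); apply: val_inj.
have [x <-] := mult_cls_surj m'; rewrite mult_mapE.
apply: val_inj; rewrite thetaE /=.
by have := valP x; rewrite capIE kernelE => /andP[/eqP].
Qed.
End Extension.

Theorem proposition5p2 (K : fieldType) (two_neq0 : (2%:R : K) != 0)
    (c : nat) (c_gt0 : (0 < c)%N)
    (g q : leibnizType K) (pi : {leibniz g -> q})
    (pi_surj : forall y : q, exists x : g, pi x = y)
    (central : lie_central pi c)
    (f : leibnizType K) (f_free : free_leibniz f) (rho : {leibniz f -> g})
    (rho_surj : forall y : g, exists x : f, rho x = y) :
  [<-> lie_stem pi c;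
       forall x : sub_of (kernel pi), ker_to_quot pi c x = 0;
       forall x : sub_of (kernel pi), exists m, theta rho central m = x;
       ganea_exact rho central;
       bijective (quot_map pi c) ].
Proof.
tfae.
- by move=> [_ ng] x; apply/ker_to_quot_eq0/ng/(valP x).
- move=> n0; apply/theta_surj => // x nx.
  by have /ker_to_quot_eq0 := n0 (exist _ x nx).
(* Exactness at the two multipliers follows from centrality alone; [surj] gives exactness at the
   kernel of [pi]. *)
- move=> surj; split=> // m; [exact: mult_map_ker_ganea | exact: theta_ker_mult_map].
- by case=> _ _ /theta_surj ng; apply/quot_map_bij => //; apply: ng.
- by move=> /quot_map_bij ng; split=> //; apply: ng.
Qed.
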